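(* Let $k\ge 1$ and let $s$ be a constellation of $j$ gaps in $\mathcal{G}(p_k)$ such that the sum of these $j$ gaps is less than $2p_{k+1}$. Let $S$ be the set of all constellations $\bar{s}$ which would produce $s$ upon one addition of adjacent gaps. Then the numbers $N_s(p)$ of occurrences of $s$ in $\mathcal{G}(p)$ satisfy $$N_s(p_{k+1})=\bigl(p_{k+1}-(j+1)\bigr)\cdot N_s(p_k)+\sum_{\bar{s}\in S}N_{\bar{s}}(p_k).$$
   Context: $p_i$ denotes the $i$-th prime ($p_1=2$), $\Pi_k=\prod_{i=1}^k p_i$, and $\Phi_k=\prod_{i=1}^k(p_i-1)$. The cycle of gaps $\mathcal{G}(p_k)=(g_{k,1},\ldots,g_{k,\Phi_k})$ is the sequence of differences between consecutive integers in $[1,\Pi_k+1]$ that are coprime to $\Pi_k$, in increasing order starting from $1$; it is regarded as a cycle, with indices extended periodically by $g_{k,i+\Phi_k}=g_{k,i}$. A constellation is a finite sequence $s=(a_1,\ldots,a_j)$ of positive integers (gaps). An occurrence of $s$ in $\mathcal{G}(p_k)$ is an index $i\in\{1,\ldots,\Phi_k\}$ with $g_{k,i+l-1}=a_l$ for $l=1,\ldots,j$; $N_s(p_k)$ is the number of such occurrences, and $s$ is a constellation in $\mathcal{G}(p_k)$ if it has at least one occurrence. A sequence $\bar{s}=(c_1,\ldots,c_{j+1})$ of $j+1$ positive integers produces $s$ upon one addition if for some $1\le i\le j$ replacing the adjacent entries $c_i,c_{i+1}$ by the single entry $c_i+c_{i+1}$ yields $s$. *)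

(* Defs.v *)
From mathcomp Require Import all_boot all_order all_algebra.
From mathcomp Require Import classical_sets cardinality fsbigop.

Set Implicit Arguments.
Unset Strict Implicit.
Unset Printing Implicit Defensive.

Lemma ex_next_prime (n : nat) : exists p, (n < p) && prime p.
Proof. by have [p np pp] := prime_above n; exists p; rewrite np. Qed.

Definition next_prime (n : nat) : nat := ex_minn (ex_next_prime n).

(* Numbered from 1: [nth_prime 1 = 2], [nth_prime 2 = 3]; [nth_prime 0 = 1] is
   a junk value. *)
Definition nth_prime (i : nat) : nat := iter i next_prime 1.

Definition primorial (k : nat) : nat := \prod_(1 <= i < k.+1) nth_prime i.

Definition Phi (k : nat) : nat := \prod_(1 <= i < k.+1) (nth_prime i - 1).

(* The increasing list of the integers of [1, primorial k + 1] coprime to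
   [primorial k]; it starts with 1 and ends with [primorial k + 1]. *)
Definition coprimes (k : nat) : seq nat :=
  [seq x <- iota 1 (primorial k).+1 | coprime x (primorial k)].

Definition cycle_of_gaps (k : nat) : seq nat :=
  [seq xy.2 - xy.1 | xy <- zip (coprimes k) (behead (coprimes k))].

(* The gap g_{k,i}, for i >= 1, extended periodically with period [Phi k],
   which is the length of [cycle_of_gaps k] (lemma [size_cycle_of_gaps]). *)
Definition gap (k i : nat) : nat :=
  nth 0 (cycle_of_gaps k) (i.-1 %% Phi k).

Definition constellation (s : seq nat) : bool := all (fun a => 0 < a) s.

(* The occurrence index [i] is counted from 1, the entries of [s] from 0. *)
Definition occurs_at (k : nat) (s : seq nat) (i : nat) : bool :=
  [forall l : 'I_(size s), gap k (i + l) == nth 0 s l].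

Definition occurrences (k : nat) (s : seq nat) : nat :=
  count (occurs_at k s) (iota 1 (Phi k)).

Definition constellation_in (k : nat) (s : seq nat) : bool :=
  constellation s && (0 < occurrences k s).

(* Replaces the entries of [t] at the 0-based positions [i] and [i.+1] by
   their sum. *)
Definition add_adjacent (i : nat) (t : seq nat) : seq nat :=
  take i t ++ (nth 0 t i + nth 0 t i.+1) :: drop i.+2 t.

Definition produces (t s : seq nat) : Prop :=
  [/\ constellation t, size t = (size s).+1
    & exists2 i, i < size s & add_adjacent i t = s].

Definition producers (s : seq nat) : set (seq nat) :=
  [set t | produces t s]%classic.

Lemma ltn_nth_prime (i : nat) : nth_prime i < nth_prime i.+1.
Proof. by rewrite /nth_prime iterS /next_prime; case: ex_minnP => m /andP[]. Qed.

Lemma prime_nth_prime (i : nat) : 0 < i -> prime (nth_prime i).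
Proof.
by case: i => // i _; rewrite /nth_prime iterS /next_prime; case: ex_minnP => m /andP[].
Qed.

Lemma nth_prime_homo : {homo nth_prime : i j / i < j}.
Proof. by apply: homo_ltn; [exact: ltn_trans | exact: ltn_nth_prime]. Qed.

Lemma primorial_gt0 (k : nat) : 0 < primorial k.
Proof.
rewrite /primorial big_nat_cond prodn_cond_gt0 // => i /andP[/andP[i0 _] _].
exact/prime_gt0/prime_nth_prime.
Qed.

Lemma totient_primorial (k : nat) : totient (primorial k) = Phi k.
Proof.
rewrite /primorial /Phi; elim: k => [|k IHk]; first by rewrite !big_geq.
have pk : prime (nth_prime k.+1) by exact: prime_nth_prime.
rewrite !(big_nat_recr k.+1) //= totient_coprime ?IHk ?totient_prime ?subn1 //.
rewrite coprime_sym prime_coprime // big_nat_cond.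
apply: (big_ind (fun m => ~~ (nth_prime k.+1 %| m))) => [|x y Hx Hy|i].
- by rewrite Euclid_dvd1.
- by rewrite Euclid_dvdM // negb_or Hx.
move=> /andP[/andP[i0 ik] _].
by rewrite dvdn_prime2 ?prime_nth_prime // gtn_eqF ?nth_prime_homo.
Qed.

Lemma size_cycle_of_gaps (k : nat) : size (cycle_of_gaps k) = Phi k.
Proof.
rewrite size_map size_zip size_behead (minn_idPr (leq_pred _)).
have n0 := primorial_gt0 k; rewrite /coprimes -totient_primorial.
rewrite -[X in iota 1 X]addn1 iotaD filter_cat size_cat add1n /=.
rewrite coprimeSn addn1 /=.
rewrite totient_count_coprime size_filter -sum1_count (iotaDl 1 0) big_map.
rewrite big_mkcond /= -{1 3}(prednK n0) -[iota 0 _]/(index_iota 0 _.+1).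
rewrite big_nat_recr // big_nat_recl //= add1n (prednK n0) addnC.
rewrite /coprime gcdnn gcdn0; congr (_ + _).
by apply: eq_bigr => i _; rewrite add1n gcdnC; case: eqP.
Qed.

Lemma sumn_add_adjacent (i : nat) (t : seq nat) :
  i.+1 < size t -> sumn (add_adjacent i t) = sumn t.
Proof.
move=> it; rewrite -[in RHS](cat_take_drop i t) (drop_nth 0) ?(ltnW it) //.
by rewrite /add_adjacent (drop_nth 0 it) !sumn_cat /= -addnA.
Qed.

(* Hence a sum [\sum_(t \in producers s) F t], which is 0 by convention when the
   support is infinite, never takes this default value. *)
Lemma finite_producers (s : seq nat) : finite_set (producers s).
Proof.
pose f (t : (size s).+1.-tuple 'I_(sumn s).+1) : seq nat := map val t.
apply: (@sub_finite_set _ _ (f @` setT)%classic); last first.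
  exact/finite_image/finite_finset.
move=> t [_ st [i si ts]].
have sumt : sumn t = sumn s by rewrite -ts sumn_add_adjacent ?st.
have t_le x : x \in t -> x < (sumn s).+1.
  by move=> xt; rewrite ltnS -sumt sumnE (big_rem x) //= leq_addr.
have szt : size (map (@inord (sumn s)) t) == (size s).+1 by rewrite size_map st.
exists (Tuple szt) => //=; rewrite /f /= -map_comp -[RHS]map_id.
by apply/eq_in_map => x /t_le xs; rewrite /= inordK.
Qed.

(* Main.v *)
Require Import Defs.
From mathcomp Require Import all_boot all_order all_algebra.
From mathcomp Require Import classical_sets cardinality fsbigop.
From mathcomp Require Import zify.

(* Occurrences of [s] in the cycle of gaps correspond to residues [n] modulo
   [P], the primorial, such that the integers of [n, n + sumn s] coprime to [P]
   are exactly the partial sums of [s] laid out from [n].  Such an [n] lifts to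
   the [p] residues [n + m P] modulo [P p].  Two integers of the window coprime
   to [P] are both odd, so they differ by an even number below [2 p], and at
   most one of them is divisible by [p] in a given lift; each of them is
   divisible by [p] in exactly one lift.  The [size s + 1] end points of a match
   of [s] thus destroy it in [size s + 1] different lifts, and a match of a
   sequence producing [s] becomes a match of [s] in the one lift where the
   additional end point is divisible by [p]. *)

(** * Matches of a gap sequence, and splits of its entries *)

Local Open Scope nat_scope.

(** The closing end point is tested as well, hence the value [C n] on the empty sequence: a match
    has [size s + 1] end points. *)
Fixpoint matches (C : pred nat) (n : nat) (s : seq nat) : bool :=
  if s is a :: s' then
    [&& C n, all (fun l => ~~ C (n + l)) (iota 1 a.-1) & matches C (n + a) s']
  else C n.

Lemma matches_start (C : pred nat) n s : matches C n s -> C n.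
Proof. by case: s => [|a s] //= /and3P[]. Qed.

Lemma matches_shift (C : pred nat) d n s :
  matches C (n + d) s = matches (fun x => C (x + d)) n s.
Proof.
elim: s n => [|a s IHs] n //=; rewrite addnAC IHs; congr [&& _, _ & _].
by apply: eq_all => l; rewrite addnAC.
Qed.

Lemma eq_in_matches (C C' : pred nat) n s :
  {in iota n (sumn s).+1, C =1 C'} -> matches C n s = matches C' n s.
Proof.
elim: s n => [|a s IHs] n eqC /=; first by apply: eqC; rewrite mem_iota; lia.
rewrite (eqC n) ?mem_iota; last by lia.
rewrite (IHs (n + a)); last first.
  by move=> x; rewrite mem_iota => xi; apply: eqC; rewrite mem_iota /=; lia.
congr [&& _, _ & _]; apply: eq_in_all => l; rewrite mem_iota => li.
by rewrite eqC // mem_iota /=; lia.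
Qed.

(* Pairs each way of splitting an entry of [s] into two positive parts with the
   position of the new end point, for [s] laid out from [n]. *)
Fixpoint marked_splits (n : nat) (s : seq nat) : seq (seq nat * nat) :=
  if s is a :: s' then
    [seq ([:: c, a - c & s'], n + c) | c <- iota 1 a.-1] ++
    [seq (a :: tx.1, tx.2) | tx <- marked_splits (n + a) s']
  else [::].

Definition splits (s : seq nat) : seq (seq nat) := unzip1 (marked_splits 0 s).

(** The start [n] affects only the marks, so one list of splits serves all windows, and sums over
    windows and over splits can be exchanged. *)
Lemma unzip1_marked_splits n s : unzip1 (marked_splits n s) = splits s.
Proof.
rewrite /splits; elim: s n 0 => [|a s IHs] n m //=.
rewrite /unzip1 !map_cat -!map_comp; congr (_ ++ _).
by have := IHs (n + a) (m + a); rewrite /unzip1 => /(congr1 (map (cons a)));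
   rewrite -!map_comp.
Qed.

Lemma splits_cons a s :
  splits (a :: s) =
    [seq [:: c, a - c & s] | c <- iota 1 a.-1] ++ [seq a :: t | t <- splits s].
Proof.
rewrite -(unzip1_marked_splits (0 + a) s) /splits /unzip1 /= map_cat -!map_comp.
by [].
Qed.

(** Splitting the first entry makes the head smaller than [a], splitting a later one keeps it.
    Uniqueness lets the sum over [producers s] be taken over this list. *)
Lemma uniq_splits s : uniq (splits s).
Proof.
elim: s => [|a s IHs] //; rewrite splits_cons cat_uniq; apply/and3P; split.
- by rewrite map_inj_uniq ?iota_uniq // => x y [].
- apply/hasPn => _ /mapP[t _ ->]; apply/mapP => -[c].
  by rewrite mem_iota => ci [] ac; lia.
- by rewrite (map_inj_uniq (f := cons a)) // => x y [].
Qed.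

Lemma mem_splits s t : constellation s -> (t \in splits s) <-> produces t s.
Proof.
elim: s t => [|a s IHs] t /=.
  by move=> _; split=> // -[_ _ []].
move=> /andP[a0 s0]; rewrite splits_cons mem_cat; split.
  case/orP => /mapP[].
    move=> c; rewrite mem_iota => ci ->; split=> //=.
      by rewrite s0 andbT; lia.
    by exists 0 => //; rewrite /add_adjacent /= drop0 subnKC //; lia.
  move=> u /(IHs _ s0)[u0 szu [i si us]] ->; split=> /=; rewrite ?a0 ?szu //.
  by exists i.+1 => //; rewrite -us.
case: t => [|c t] [] //= /andP[c0 t0] [szt] [[|i]].
  move=> _; case: t szt t0 => [|d t] //= szt /andP[d0 t0].
  rewrite /add_adjacent /= drop0 => -[<- <-]; apply/orP; left.
  by apply/mapP; exists c; rewrite ?mem_iota ?addKn //; lia.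
rewrite ltnS => si [-> ts]; apply/orP; right.
rewrite mem_map; last by move=> x y [].
by apply/(IHs _ s0); split => //; exists i.
Qed.

(* Since at most one [C]-point of the window is bad, removing the bad points
   either breaks a match of [s] at an end point or turns a match of a split of
   [s] into a match of [s]. *)
Lemma matches_sieve (C bad : pred nat) n s :
  constellation s ->
  (forall x y, n <= x <= n + sumn s -> n <= y <= n + sumn s ->
    C x -> C y -> bad x -> bad y -> x = y) ->
  matches (fun x => C x && ~~ bad x) n s
    + matches C n s * \sum_(x <- n :: scanl addn n s) bad x
  = matches C n s
    + \sum_(tx <- marked_splits n s) matches C n tx.1 * bad tx.2.
Proof.
set C' := fun x => _ && _.
elim: s n => [|a s IHs] n /=.
  by move=> _ _; rewrite big_seq1 big_nil /C'; case: (C n); case: (bad n).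
move=> /andP[a0 s0] inj.
have inj' x y : n + a <= x <= n + a + sumn s -> n + a <= y <= n + a + sumn s ->
    C x -> C y -> bad x -> bad y -> x = y.
  by move=> xi yi; apply: inj; lia.
have {IHs}IH := IHs _ s0 inj'.
rewrite big_cat !big_map /=.
case Cn: (C n); last first.
  by rewrite {1}/C' Cn [in RHS]big1 // [in RHS]big1.
(* A bad point of [C] at the start of the first gap or inside it is the only one of the window, so
   the tail loses nothing. *)
have tailE z : n <= z < n + a -> C z -> bad z ->
    matches C' (n + a) s = matches C (n + a) s.
  move=> zi Cz bz; apply: eq_in_matches => x; rewrite mem_iota => xi.
  rewrite /C'; case Cx: (C x) => //=; case bx: (bad x) => //=.
  have := inj z x; rewrite Cz Cx bz bx => H.
  have : z = x by apply: H => //; lia.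
  by lia.
have C'n : C' n = ~~ bad n by rewrite /C' Cn.
rewrite C'n /=.
(* With no point of [C] inside the first gap, its splits contribute nothing and the identity reduces
   to that for the tail. *)
case: (boolP (all (fun l => ~~ C (n + l)) (iota 1 a.-1))) => [noC|].
  have noC' : all (fun l => ~~ C' (n + l)) (iota 1 a.-1).
    by apply: sub_all noC => l; rewrite /C'; case: (C (n + l)).
  rewrite noC' /= [X in _ + (X + _)]big_seq [X in _ + (X + _)]big1 ?add0n; last first.
    by move=> c /(allP noC)/negbTE Cc; rewrite Cc !andbF.
  rewrite big_cons mulnDr.
  case bn: (bad n) => /=.
    have := tailE n _ Cn bn; move: IH; lia.
  by move: IH; lia.
(* A point of [C] inside the first gap excludes matches in [C] of [s] and of the splits of its later
   entries. *)
rewrite -has_predC => /hasP[/= d dI /negPn Cd].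
rewrite [X in _ = _ + (_ + X)]big1 // !addn0 !add0n.
have {}dI : 0 < d < a by move: dI; rewrite mem_iota; lia.
case: (boolP [&& ~~ bad n, _ & _]) => [/and3P[bn noC' mC']|noM] /=.
  (* In a sieved match all points of [C] inside the first gap are bad, hence equal to [n + d]: only
     the split at [d] matches. *)
  have badP l : 0 < l < a -> C (n + l) -> bad (n + l).
    move=> li Cl; have := allP noC' l; rewrite mem_iota /C' Cl /= negbK; apply.
    by lia.
  have Cd_uniq l : 0 < l < a -> C (n + l) -> l = d.
    move=> li Cl; have := inj (n + l) (n + d).
    move=> /(_ _ _ Cl Cd (badP _ li Cl) (badP _ dI Cd)) H.
    have e : n + l = n + d by apply: H; lia.
    by lia.
  rewrite (bigD1_seq d) ?iota_uniq ?mem_iota /=; [|by lia|by []].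
  rewrite badP // Cd -addnA subnKC; last by lia.
  rewrite -(tailE (n + d)) ?badP //; last by lia.
  rewrite mC' andbT big_seq_cond big1 ?addn0; last first.
    move=> c /andP[]; rewrite mem_iota => ci cd.
    case Cc: (C (n + c)); rewrite ?andbF //.
    by move: cd; rewrite (Cd_uniq c) ?eqxx //; lia.
  rewrite muln1; apply/esym/eqP; rewrite eqb1; apply/andP; split.
    apply/allP => l; rewrite mem_iota => li; apply/negP => Cl.
    have ld : l = d by apply: Cd_uniq => //; lia.
    by lia.
  apply/allP => l; rewrite mem_iota -addnA => li; apply/negP => Cl.
  have ld : d + l = d by apply: Cd_uniq => //; lia.
  by lia.
(* Conversely, a matching split with a bad mark would give a sieved match of [s]. *)
rewrite big_seq big1 // => c; rewrite mem_iota => ci.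
apply/eqP; rewrite muln_eq0 !eqb0 -negb_and; apply: contra noM.
case/andP => /and3P[noC1 Cc /andP[noC2]]; rewrite -addnA subnKC; last by lia.
move=> mC bc; apply/and3P; split.
- apply/negP => bn.
  have nc : n = n + c by apply: inj => //; lia.
  by lia.
- apply/allP => l; rewrite mem_iota => li; rewrite /C' negb_and negbK.
  case: (ltngtP l c) => lc.
  + by rewrite (allP noC1) // mem_iota; lia.
  + have := allP noC2 (l - c); rewrite mem_iota -addnA subnKC; last by lia.
    by move=> -> //; lia.
  + by rewrite lc bc orbT.
- by rewrite (tailE (n + c)) //; lia.
Qed.

(** * Lifting windows from modulus [P] to modulus [P * p] *)

Lemma count_residue p P x : prime p -> coprime p P ->
  \sum_(m < p) (p %| x + m * P) = 1.
Proof.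
move=> pp cpP.
(* As [P] is invertible modulo [p], the [p] lifts have distinct residues, so exactly one of these is
   0. *)
have inj : injective
    (fun m : 'I_p => Ordinal (ltn_pmod (x + m * P) (prime_gt0 pp))).
  move=> m1 m2 [] /eqP; rewrite eqn_modDl => E; apply/val_inj => /=.
  move: E; wlog le12 : m1 m2 / m1 <= m2 => [W|].
    by case: (leqP m1 m2) => [/W //|/ltnW/W H]; rewrite eq_sym => /H.
  rewrite eq_sym eqn_mod_dvd ?leq_mul2r ?le12 ?orbT // -mulnBl Gauss_dvdl //.
  move=> /dvdn_leq; have := ltn_ord m2; lia.
pose f := invF inj (Ordinal (prime_gt0 pp)).
have fE := f_invF inj (Ordinal (prime_gt0 pp)).
rewrite (bigD1 f) //= big1 ?addn0 => [|m mf].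
  by have /(congr1 val) /= := fE; rewrite -/f => E; rewrite /dvdn E.
apply/eqP; rewrite eqb0; apply: contra mf => /eqP E; apply/eqP/inj.
by rewrite fE; apply/val_inj.
Qed.

Lemma sum_iota_mul (F : nat -> nat) P p :
  \sum_(n <- iota 1 (P * p)) F n =
  \sum_(n <- iota 1 P) \sum_(m < p) F (n + m * P).
Proof.
elim: p => [|p IHp].
  by rewrite muln0 big_nil big1 // => n _; rewrite big_ord0.
under [RHS]eq_bigr do rewrite big_ord_recr /=.
rewrite big_split -IHp mulnS addnC iotaD big_cat /=; congr (_ + _).
by rewrite addnC iotaDl big_map; apply: eq_bigr => n _; rewrite addnC mulnC.
Qed.

Lemma coprime_sieve_inj P p m x y : prime p -> 2 < p -> 2 %| P ->
  x <= y < x + 2 * p ->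
  coprime x P -> coprime y P -> p %| x + m * P -> p %| y + m * P -> x = y.
Proof.
move=> pp p2 P2 xy cx cy dx dy.
have oddC z : coprime z P -> odd z.
  by move=> /(coprime_dvdr P2); rewrite coprimen2.
have : p * 2 %| y - x.
  rewrite Gauss_dvd; last by rewrite coprimen2; case: (even_prime pp) p2 => [->|].
 
  rewrite dvdn2 oddB ?(oddC x) ?(oddC y) // ?andbT; last by lia.
  by rewrite -(subnDr (m * P)) dvdn_sub.
by case: (posnP (y - x)) => [|yx0 /(dvdn_leq yx0)]; lia.
Qed.

(** This is [matches_sieve] summed over the [p] lifts. The lost lifts stand on the left, which
    avoids a truncated subtraction. *)
Lemma sieve_count P p n s : prime p -> 2 < p -> 2 %| P -> coprime p P ->
  constellation s -> sumn s < 2 * p ->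
  \sum_(m < p) matches (coprime^~ (P * p)) (n + m * P) s
    + (size s).+1 * matches (coprime^~ P) n s
  = p * matches (coprime^~ P) n s
    + \sum_(t <- splits s) matches (coprime^~ P) n t.
Proof.
move=> pp p2 P2 cpP s0 sp; set C := coprime^~ P.
(* The window stays fixed at [n]; the lift enters only through the sieving condition. *)
pose bad m x := p %| x + m * P.
have sieve (m : 'I_p) : matches (coprime^~ (P * p)) (n + m * P) s
    + matches C n s * \sum_(x <- n :: scanl addn n s) bad m x
  = matches C n s
    + \sum_(tx <- marked_splits n s) matches C n tx.1 * bad m tx.2.
  rewrite -matches_sieve //; last first.
    move=> x y xi yi Cx Cy bx b_y.
    case: (leqP x y) => xy; first by apply: (@coprime_sieve_inj P p m x y) => //; lia.
    by apply/esym/(@coprime_sieve_inj P p m y x) => //; lia.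
  congr (nat_of_bool _ + _); rewrite matches_shift; apply: eq_in_matches => x _.
  rewrite coprimeMr /C /bad [coprime _ p]coprime_sym (prime_coprime _ pp) //.
  by rewrite -coprime_modl [in X in X %% P]addnC modnMDl coprime_modl.
have sum_bad x : \sum_(m < p) bad m x = 1 by exact: count_residue.
have := @eq_bigr _ 0 addn _ (index_enum 'I_p) xpredT _ _ (fun m _ => sieve m).
rewrite !big_split /= sum_nat_const card_ord -big_distrr /=.
have -> : \sum_(m < p) \sum_(x <- n :: scanl addn n s) bad m x = (size s).+1.
  rewrite exchange_big /= (eq_bigr (fun=> 1)) // sum1_size /=.
  by rewrite size_scanl.
have -> : \sum_(m < p) \sum_(tx <- marked_splits n s)
      matches C n tx.1 * bad m tx.2
    = \sum_(t <- splits s) matches C n t.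
  rewrite exchange_big -(unzip1_marked_splits n) big_map /=.
  by apply: eq_bigr => tx _; rewrite -big_distrr /= sum_bad muln1.
by rewrite [_ * (size s).+1]mulnC => ->.
Qed.

(** * From the cycle of gaps to matches in the integers *)

Lemma coprimesE k :
  coprimes k = rcons [seq x <- iota 1 (primorial k) | coprime x (primorial k)]
                     (primorial k).+1.
Proof.
rewrite /coprimes -[(primorial k).+1 in LHS]addn1 iotaD filter_cat /= add1n.
by rewrite coprimeSn cats1 ?primorial_gt0.
Qed.

Lemma size_coprimes k : size (coprimes k) = (Phi k).+1.
Proof.
rewrite -size_cycle_of_gaps size_map size_zip size_behead.
by rewrite (minn_idPr (leq_pred _)) coprimesE size_rcons.
Qed.

Lemma Phi_gt0 k : 0 < Phi k.
Proof. by rewrite -totient_primorial totient_gt0 primorial_gt0. Qed.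

Lemma nth_coprimes_last k : nth 0 (coprimes k) (Phi k) = (primorial k).+1.
Proof.
have := size_coprimes k; rewrite coprimesE size_rcons => -[<-].
by rewrite nth_rcons ltnn eqxx.
Qed.

Lemma nth_coprimes0 k : nth 0 (coprimes k) 0 = 1.
Proof. by rewrite /coprimes /= coprime1n. Qed.

Lemma coprime_nth_coprimes k r : r <= Phi k ->
  coprime (nth 0 (coprimes k) r) (primorial k).
Proof.
move=> rk; have := @mem_nth _ 0 (coprimes k) r.
by rewrite size_coprimes ltnS mem_filter => /(_ rk)/andP[].
Qed.

Lemma gapE k i : gap k i.+1 =
  nth 0 (coprimes k) (i %% Phi k).+1 - nth 0 (coprimes k) (i %% Phi k).
Proof.
have szz : size (zip (coprimes k) (behead (coprimes k))) = Phi k.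
  by rewrite -size_cycle_of_gaps size_map.
have ik : i %% Phi k < Phi k by rewrite ltn_pmod ?Phi_gt0.
by rewrite /gap (nth_map (0, 0)) ?szz // nth_zip_cond szz ik nth_behead.
Qed.

Lemma coprimes_consecutive k r x : r < Phi k ->
  nth 0 (coprimes k) r < x < nth 0 (coprimes k) r.+1 ->
  ~~ coprime x (primorial k).
Proof.
move=> rk xr; apply/negP => cx; set c := coprimes k in xr.
have szc : size c = (Phi k).+1 by exact: size_coprimes.
have sc : sorted ltn c.
  by apply: sorted_filter (iota_ltn_sorted _ _); exact: ltn_trans.
have lt_c i j : i <= j -> j <= Phi k -> nth 0 c i <= nth 0 c j.
  move=> ij jk; have := sorted_leq_nth leq_trans leqnn 0 (sub_sorted ltnW sc).
  by apply; rewrite ?inE ?szc //; lia.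
(* The extreme entries 1 and [primorial k + 1] enclose [x], so it would be an entry, but no index is
   left for it between [r] and [r.+1]. *)
have xc : x \in c.
  rewrite mem_filter cx mem_iota.
  have := lt_c 0 r; have := lt_c r.+1 (Phi k).
  by rewrite nth_coprimes0 nth_coprimes_last; lia.
have xlt : index x c < size c by rewrite index_mem.
have xE := nth_index 0 xc.
case: (leqP (index x c) r) => [ir|ri].
  by have := lt_c _ _ ir; rewrite xE; lia.
by have := lt_c _ _ ri; rewrite xE; lia.
Qed.

Lemma ltn_nth_coprimes k r : r < Phi k ->
  nth 0 (coprimes k) r < nth 0 (coprimes k) r.+1.
Proof.
move=> rk; have := @sorted_ltn_nth _ ltn ltn_trans 0 (coprimes k).
apply; rewrite ?inE ?size_coprimes //; last by lia.
by apply: sorted_filter (iota_ltn_sorted _ _); exact: ltn_trans.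
Qed.

Lemma matches_period P n s :
  matches (coprime^~ P) (n + P) s = matches (coprime^~ P) n s.
Proof.
rewrite matches_shift; apply: eq_in_matches => x _.
by rewrite /= -coprime_modl modnDr coprime_modl.
Qed.

Lemma occurs_at_matches k s i : constellation s ->
  occurs_at k s i.+1 =
    matches (coprime^~ (primorial k)) (nth 0 (coprimes k) (i %% Phi k)) s.
Proof.
elim: s i => [|a s IHs] i /=.
  move=> _; rewrite coprime_nth_coprimes; last by rewrite ltnW ?ltn_pmod ?Phi_gt0.
  by apply/forallP => -[].
move=> /andP[a0 s0].
have -> : occurs_at k (a :: s) i.+1 = (gap k i.+1 == a) && occurs_at k s i.+2.
  apply/forallP/andP => [H|[ga /forallP H] [[|l] ls]] /=.
  - split; first by have := H ord0; rewrite addn0.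
    by apply/forallP => l; have := H (lift ord0 l); rewrite /= /bump add1n addnS.
  - by rewrite addn0.
  - by have := H (Ordinal (ls : l < size s)); rewrite addnS.
rewrite IHs // gapE; set r := i %% Phi k.
have rk : r < Phi k by rewrite ltn_pmod ?Phi_gt0.
have -> : matches (coprime^~ (primorial k)) (nth 0 (coprimes k) (i.+1 %% Phi k)) s
  = matches (coprime^~ (primorial k)) (nth 0 (coprimes k) r.+1) s.
  (* At the end of the cycle the index wraps from the entry [primorial k + 1] to the entry 1, a
     shift by one full period. *)
  rewrite -addn1 -modnDml addn1 -/r.
  case: (ltngtP r.+1 (Phi k)) => rk1; [by rewrite modn_small | by lia |].
  by rewrite rk1 modnn nth_coprimes_last nth_coprimes0 -(matches_period _ 1) add1n.
have := ltn_nth_coprimes _ _ rk.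
have := fun x => @coprimes_consecutive k r x rk.
have := coprime_nth_coprimes _ _ rk; have := coprime_nth_coprimes _ _ (ltnW rk).
move: (nth 0 _ r) (nth 0 _ r.+1) => x y cx cy none xy.
apply/andP/and3P => [[/eqP <- my]|[_ /allP na mxa]].
  split => //; last by rewrite subnKC // ltnW.
  by apply/allP => l; rewrite mem_iota => li; apply: none; lia.
(* The match of the tail certifies that [x + a] is coprime to the primorial, so it must be the next
   such integer [y]. *)
have cxa := matches_start _ _ _ mxa.
have ya : y = x + a.
  apply/eqP; rewrite eqn_leq; apply/andP; split.
    by rewrite leqNgt; apply/negP => lt; have := none (x + a); rewrite cxa => H;
       suff: false by []; apply: H; lia.
  rewrite leqNgt; apply/negP => lt; have := na (y - x).
  rewrite mem_iota subnKC ?(ltnW xy) // cy => H.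
  by suff: false by []; apply: H; lia.
by rewrite ya addKn eqxx.
Qed.

(** A match can only start at a coprime integer, so the sum may run over a whole period; in this
    form [sum_iota_mul] cuts it into lifts. *)
Lemma occurrencesE k s : constellation s ->
  occurrences k s = \sum_(n <- iota 1 (primorial k))
    matches (coprime^~ (primorial k)) n s.
Proof.
move=> s0; set C := coprime^~ _.
rewrite /occurrences (iotaDl 1 0) count_map.
rewrite (eq_in_count (a2 := fun i => matches C (nth 0 (coprimes k) i) s)).
  rewrite -(count_map (nth 0 (coprimes k)) (fun n => matches C n s)).
  have szf := size_coprimes k; rewrite coprimesE size_rcons in szf.
  case: szf => <-; set f := filter _ _.
  (* Indices below [Phi k] leave out the closing entry [primorial k + 1], so each start is counted
     once. *)
  rewrite (_ : map _ _ = f); last first.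
    rewrite -[RHS](mkseq_nth 0) /mkseq; apply/eq_in_map => i; rewrite mem_iota.
    by move=> /andP[_]; rewrite add0n => ik; rewrite coprimesE -/f nth_rcons ik.
  rewrite count_filter -sum1_count big_mkcond; apply: eq_bigr => n _ /=.
  by case mC: (matches C n s) => //; rewrite [coprime _ _](matches_start _ _ _ mC).
by move=> i; rewrite mem_iota => ik /=; rewrite add1n occurs_at_matches // modn_small.
Qed.

Local Open Scope ring_scope.

Theorem theorem4p2 (k j : nat) (s : seq nat) :
  (1 <= k)%N ->
  size s = j ->
  constellation_in k s ->
  (sumn s < 2 * nth_prime k.+1)%N ->
  (occurrences k.+1 s)%:Z =
    ((nth_prime k.+1)%:Z - (j%:Z + 1)) * (occurrences k s)%:Z
    + \sum_(t \in producers s) (occurrences k t)%:Z.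
Proof.
move=> k1 <- /andP[s0 _] sp; set p := nth_prime k.+1 in sp *.
have pp : prime p by exact: prime_nth_prime.
(* Since [k >= 1], an earlier prime exists, so [p] is odd. *)
have p2 : (2 < p)%N.
  by apply: leq_ltn_trans (ltn_nth_prime k); exact/prime_gt1/prime_nth_prime.
have PS : primorial k.+1 = (primorial k * p)%N by rewrite /primorial big_nat_recr.
have P2 : (2 %| primorial k)%N.
  rewrite /primorial big_ltn // dvdn_mulr // /nth_prime /= /next_prime.
  case: ex_minnP => m /andP[m1 _] /(_ 2 isT) m2.
  by rewrite (_ : m = 2) //; lia.
have cpP : coprime p (primorial k).
  rewrite prime_coprime // /primorial big_nat_cond.
  apply: (big_ind (fun m => ~~ (p %| m)%N)) => [|x y Hx Hy|i].
  - by rewrite Euclid_dvd1.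
  - by rewrite Euclid_dvdM // negb_or Hx.
  move=> /andP[/andP[i0 ik] _].
  by rewrite dvdn_prime2 ?prime_nth_prime // gtn_eqF ?nth_prime_homo.
have -> : \sum_(t \in producers s) (occurrences k t)%:Z
    = (\sum_(t <- splits s) occurrences k t)%N%:Z.
  rewrite (_ : producers s = [set` splits s])%classic; last first.
    by apply/seteqP; split => t /= /(mem_splits s t s0).
  by rewrite -fsbig_seq ?uniq_splits // (big_morph Posz PoszD (erefl 0)).
suff : (occurrences k.+1 s + (size s).+1 * occurrences k s
    = p * occurrences k s + \sum_(t <- splits s) occurrences k t)%N by lia.
rewrite !occurrencesE // PS sum_iota_mul !big_distrr /= -big_split /=.
under eq_bigr do rewrite sieve_count //.
rewrite big_split /= -big_distrr /= exchange_big /=; congr (_ + _)%N.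
rewrite big_seq [RHS]big_seq; apply: eq_bigr => t /(mem_splits s t s0)[t0 _ _].
by rewrite occurrencesE.
Qed.
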